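(* For all positive integers $m,n,j,k$, $$ \begin{aligned} &\zeta(m+1,\{1\}^{j-1})\,\zeta(n+1,\{1\}^{k-1})\\ &=\sum_{\substack{0\le n_1\le n\\ j_1+j_2=j,\ j_i\ge 0\\ |\alpha|=n-n_1+j_1+1}}\binom{m-1+n_1}{m-1}\binom{j_2+k-1}{k-1}\,\zeta\big(\alpha_1+m+n_1,\alpha_2,\ldots,\alpha_{j_1},\alpha_{j_1+1},\{1\}^{j_2+k-1}\big)\\ &\quad+\sum_{\substack{0\le t\le k-1\\ m_1+m_2=m-1,\ m_i\ge 0\\ |\beta|=m_2+k-t+1}}\binom{m_1+n-1}{n-1}\binom{j+t}{j}\,\zeta\big(\beta_1+m_1+n,\beta_2,\ldots,\beta_{k-t},\beta_{k-t+1}+1,\{1\}^{j+t-1}\big), \end{aligned} $$ where in the first sum $(n_1,j_1,j_2)$ ranges over the indicated integers and, for each of them, $\alpha=(\alpha_1,\ldots,\alpha_{j_1+1})$ ranges over all tuples of integers $\alpha_i\ge 1$ with $|\alpha|:=\alpha_1+\cdots+\alpha_{j_1+1}=n-n_1+j_1+1$; and in the second sum $(t,m_1,m_2)$ ranges over the indicated integers and, for each of them, $\beta=(\beta_1,\ldots,\beta_{k-t+1})$ ranges over all tuples of integers $\beta_i\ge 1$ with $|\beta|:=\beta_1+\cdots+\beta_{k-t+1}=m_2+k-t+1$.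
   Context: For positive integers $s_1,\ldots,s_r$ with $s_1\ge 2$, the multiple zeta value is the real number $$\zeta(s_1,\ldots,s_r)=\sum_{n_1>n_2>\cdots>n_r\ge 1}\frac{1}{n_1^{s_1}\cdots n_r^{s_r}}.$$ $\{1\}^p$ denotes the string $1,\ldots,1$ with $p$ terms (the empty string if $p=0$). Convention: when $j_1=0$, the string $\alpha_1+m+n_1,\alpha_2,\ldots,\alpha_{j_1},\alpha_{j_1+1}$ means the single entry $\alpha_1+m+n_1$. When $k-t=1$, the string $\beta_1+m_1+n,\beta_2,\ldots,\beta_{k-t},\beta_{k-t+1}+1$ means $\beta_1+m_1+n,\ \beta_2+1$. *)

(* Defs.v *)
From mathcomp Require Import all_boot all_order all_algebra.
From mathcomp Require Import all_classical all_reals all_analysis.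

Set Implicit Arguments.
Unset Strict Implicit.
Unset Printing Implicit Defensive.

Local Open Scope classical_set_scope.
Local Open Scope ring_scope.

(* The sum is taken over an unordered family of nonnegative terms, so it always
   exists in \bar R; it is finite for every nonempty [s] with positive entries
   and first entry at least 2, which is the only case that is meant. *)
Definition mzv (R : realType) (s : seq nat) : R :=
  fine (\esum_(n in [set n : (size s).-tuple nat |
                       sorted gtn n /\ all (leq 1) n])
          (\prod_(i < size s) ((nth 0%N n i)%:R ^+ nth 0%N s i)^-1 : R)%:E)%E.

(* [is_comp a]: the entries of [a] are at least 1 and add up to [w].  Entries of
   such a tuple never exceed [w], so bounding them loses nothing. *)
Definition is_comp (p w : nat) (a : p.-tuple 'I_w.+1) : bool :=
  [forall i, (1 <= tnth a i)%N] && (\sum_(i < p) tnth a i == w)%N.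

(* Entries are numbered from 1. *)
Definition entry (p w : nat) (a : p.-tuple 'I_w.+1) (i : nat) : nat :=
  nth 0%N [seq val x | x <- a] i.-1.

(* (a_1 + m + n1, a_2, ..., a_(j1+1), {1}^ones); for j1 = 0 the range of the
   middle part is empty. *)
Definition first_index (m n1 j1 ones : nat) (a : nat -> nat) : seq nat :=
  (a 1 + m + n1)%N :: [seq a i | i <- index_iota 2 j1.+2] ++ nseq ones 1%N.

(* (b_1 + m1 + n, b_2, ..., b_d, b_(d+1) + 1, {1}^ones), where d = k - t >= 1. *)
Definition second_index (m1 n d ones : nat) (b : nat -> nat) : seq nat :=
  (b 1 + m1 + n)%N :: [seq b i | i <- index_iota 2 d.+1]
    ++ (b d.+1 + 1)%N :: nseq ones 1%N.

(* Main.v *)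
Require Import Defs.
From HB Require Import structures.
From mathcomp Require Import all_boot all_order all_algebra.
From mathcomp Require Import all_classical all_reals all_analysis.
From mathcomp Require Import lra zify ring.
Import Order.TTheory GRing.Theory Num.Theory.
Import numFieldNormedType.Exports.

Local Open Scope ring_scope.

(** The formula is the shuffle product of the words [x^m y^j] and [x^n y^k],
    sorted by whether the last [x] of the first word comes before or after the
    first [y] of the second one.  Instead of iterated integrals, each word is
    represented by the Taylor coefficients of its polylogarithm at 0: the
    letters [x] and [y], i.e. integration against dt/t and dt/(1-t), act on
    coefficient sequences by [opX 1] and [opY], and the Leibniz rule for
    [t d/dt] gives the shuffle recursion for Cauchy products.  A multiple zeta
    value is the sum of the coefficients of its word; all series involved
    converge because the coefficients of every word are O(1/sqrt N). *)

(** * Coefficient sequences, Cauchy products and the shuffle recursion *)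

Definition opX (F : numFieldType) (i : nat) (f : nat -> F) : nat -> F :=
  fun N => f N / N%:R ^+ i.

(** On power series this is multiplication by t/(1-t). The sum is strict, so the division by [N] in
    [opY] yields integration against dt/(1-t). *)
Definition psum (F : numFieldType) (f : nat -> F) : nat -> F :=
  fun N => \sum_(i < N) f i.

Definition opY (F : numFieldType) (f : nat -> F) : nat -> F :=
  fun N => psum F f N / N%:R.

Definition unit_coef (F : numFieldType) : nat -> F := fun N => (N == 0%N)%:R.

Definition cauchyprod (F : numFieldType) (f g : nat -> F) : nat -> F :=
  fun N => \sum_(i < N.+1) f i * g (N - i)%N.

Definition theta (F : numFieldType) (f : nat -> F) : nat -> F :=
  fun N => N%:R * f N.

Arguments opX {F}. Arguments psum {F}. Arguments opY {F}.
Arguments unit_coef {F}. Arguments cauchyprod {F}. Arguments theta {F}.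

Lemma opX_linear (F : numFieldType) i : linear (@opX F i).
Proof.
move=> a f g; apply/funext => N.
by rewrite /opX !fctE mulrDl -scalerAl.
Qed.
HB.instance Definition _ (F : numFieldType) i :=
  GRing.isLinear.Build F (nat -> F) (nat -> F) _ (@opX F i) (@opX_linear F i).

Lemma opY_linear (F : numFieldType) : linear (@opY F).
Proof.
move=> a f g; apply/funext => N.
by rewrite /opY /psum !fctE big_split /= mulrDl -scaler_sumr scalerAl.
Qed.
HB.instance Definition _ (F : numFieldType) :=
  GRing.isLinear.Build F (nat -> F) (nat -> F) _ (@opY F) (@opY_linear F).

Lemma opX0 (F : numFieldType) (f : nat -> F) : opX 0 f = f.
Proof. by apply/funext => N; rewrite /opX expr0 divr1. Qed.

Lemma opXD (F : numFieldType) i j (f : nat -> F) :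
  opX (i + j) f = opX i (opX j f).
Proof. by apply/funext => N; rewrite /opX addnC exprD invfM mulrA. Qed.

Lemma opXS (F : numFieldType) i (f : nat -> F) : opX i.+1 f = opX 1 (opX i f).
Proof. by rewrite -opXD. Qed.

Lemma opX_at0 (F : numFieldType) i (f : nat -> F) : f 0%N = 0 -> opX i f 0%N = 0.
Proof. by move=> f0; rewrite /opX f0 mul0r. Qed.

Lemma opY_at0 (F : numFieldType) (f : nat -> F) : opY f 0%N = 0.
Proof. by rewrite /opY /psum big_ord0 mul0r. Qed.

Lemma cauchyprodC (F : numFieldType) (f g : nat -> F) : cauchyprod f g = cauchyprod g f.
Proof.
apply/funext => N; rewrite /cauchyprod (reindex_inj rev_ord_inj) /=.
by apply: eq_bigr => i _; rewrite subSS subKn 1?mulrC // -ltnS.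
Qed.

Lemma cauchyprod1s (F : numFieldType) (f : nat -> F) : cauchyprod unit_coef f = f.
Proof.
apply/funext => N; rewrite /cauchyprod big_ord_recl /= mul1r subn0 big1 ?addr0 //.
by move=> i _; rewrite mul0r.
Qed.

Lemma cauchyprod_at0 (F : numFieldType) (f g : nat -> F) : f 0%N = 0 -> cauchyprod f g 0%N = 0.
Proof. by move=> f0; rewrite /cauchyprod big_ord1 f0 mul0r. Qed.

(** Multiplication by t/(1-t) commutes with multiplication by the series of [g]. *)
Lemma psum_cauchyprod (F : numFieldType) (f g : nat -> F) :
  cauchyprod (psum f) g = psum (cauchyprod f g).
Proof.
apply/funext; elim=> [|N IH].
  by rewrite /cauchyprod /psum big_ord1 !big_ord0 mul0r.
rewrite /psum big_ord_recr /= -/(psum _ N) -IH.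
rewrite /cauchyprod big_ord_recl /= /psum big_ord0 mul0r add0r -big_split /=.
by apply: eq_bigr => i _; rewrite /bump add1n subSS big_ord_recr /= mulrDl.
Qed.

Lemma theta_cauchyprod (F : numFieldType) (f g : nat -> F) :
  theta (cauchyprod f g) = cauchyprod (theta f) g + cauchyprod f (theta g).
Proof.
apply/funext => N; rewrite /theta /cauchyprod !fctE mulr_sumr -big_split /=.
apply: eq_bigr => i _.
have -> : N%:R = i%:R + (N - i)%:R :> F by rewrite -natrD subnKC // -ltnS.
by rewrite mulrDl mulrA mulrCA.
Qed.

Lemma theta_opX (F : numFieldType) (f : nat -> F) : f 0%N = 0 -> theta (opX 1 f) = f.
Proof.
move=> f0; apply/funext => -[|N]; first by rewrite /theta mul0r f0.
by rewrite /theta /opX expr1 mulrC divfK // pnatr_eq0.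
Qed.

Lemma opX_theta (F : numFieldType) (f : nat -> F) : f 0%N = 0 -> opX 1 (theta f) = f.
Proof.
move=> f0; apply/funext => -[|N]; first by rewrite /opX /theta !mul0r f0.
by rewrite /theta /opX expr1 mulrC mulKf // pnatr_eq0.
Qed.

Lemma opYE (F : numFieldType) (f : nat -> F) : opY f = opX 1 (psum f).
Proof. by []. Qed.

(** [opX 1] inverts [theta] on series without constant term, so the Leibniz rule becomes integration
    by parts. *)
Lemma cauchyprod_leibniz (F : numFieldType) (f g : nat -> F) : f 0%N = 0 ->
  cauchyprod f g = opX 1 (cauchyprod (theta f) g) + opX 1 (cauchyprod f (theta g)).
Proof.
move=> f0; rewrite -raddfD /= -theta_cauchyprod opX_theta //.
exact: cauchyprod_at0.
Qed.

Lemma theta_opY (F : numFieldType) (f : nat -> F) : theta (opY f) = psum f.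
Proof. by rewrite opYE theta_opX // /psum big_ord0. Qed.

(** This and the next two lemmas are the shuffle recursion: the outermost letter of a shuffled word
    comes from either factor. *)
Lemma cauchyprod_XX (F : numFieldType) (f g : nat -> F) : f 0%N = 0 -> g 0%N = 0 ->
  cauchyprod (opX 1 f) (opX 1 g) = opX 1 (cauchyprod f (opX 1 g)) + opX 1 (cauchyprod (opX 1 f) g).
Proof. by move=> f0 g0; rewrite (cauchyprod_leibniz _ (opX 1 f)) ?theta_opX // opX_at0. Qed.

Lemma cauchyprod_YX (F : numFieldType) (f g : nat -> F) : g 0%N = 0 ->
  cauchyprod (opY f) (opX 1 g) = opY (cauchyprod f (opX 1 g)) + opX 1 (cauchyprod (opY f) g).
Proof.
move=> g0; rewrite (cauchyprod_leibniz _ (opY f)) ?opY_at0 //.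
by rewrite theta_opX // theta_opY psum_cauchyprod.
Qed.

Lemma cauchyprod_YY (F : numFieldType) (f g : nat -> F) :
  cauchyprod (opY f) (opY g) = opY (cauchyprod f (opY g)) + opY (cauchyprod (opY f) g).
Proof.
rewrite (cauchyprod_leibniz _ (opY f)) ?opY_at0 // !theta_opY psum_cauchyprod; congr (_ + _).
by rewrite cauchyprodC psum_cauchyprod -opYE (cauchyprodC _ g).
Qed.

(** * Shuffle products of words in x and y *)

Definition powY (F : numFieldType) i : nat -> F := iter i opY unit_coef.
Arguments powY {F} i : simpl never.

Lemma powYS (F : numFieldType) i : powY i.+1 = opY (@powY F i).
Proof. by []. Qed.

Lemma powYS_at0 (F : numFieldType) i : @powY F i.+1 0%N = 0.
Proof. exact: opY_at0. Qed.

(** All interleavings of y^j and y^k are the same word; Pascal's rule counts them. *)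
Lemma cauchyprod_powY (F : numFieldType) j k :
  cauchyprod (powY j) (powY k) = 'C(j + k, j)%:R *: powY (j + k) :> (nat -> F).
Proof.
elim: j k => [|j IHj] k; first by rewrite cauchyprod1s bin0 scale1r.
elim: k => [|k IHk]; first by rewrite cauchyprodC cauchyprod1s addn0 binn scale1r.
rewrite addSnnS in IHk.
rewrite [LHS](cauchyprod_YY _ (powY j) (powY k)) -!powYS IHj IHk !linearZ /= -!powYS.
by rewrite addSn -scalerDl -natrD binS addnC.
Qed.

(* The shuffle product of [x^b] and [y^p], each word of it being applied to [f]. *)
Fixpoint shuffleXY (F : numFieldType) (p b : nat) (f : nat -> F) : nat -> F :=
  if p is p'.+1 then
    \sum_(i < b.+1) opX i (opY (shuffleXY F p' (b - i) f))
  else opX b f.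
Arguments shuffleXY {F} p b f : simpl never.

Lemma shuffleXY0 (F : numFieldType) b (f : nat -> F) : shuffleXY 0 b f = opX b f.
Proof. by []. Qed.

Lemma shuffleXYS (F : numFieldType) p b (f : nat -> F) :
  shuffleXY p.+1 b f = \sum_(i < b.+1) opX i (opY (shuffleXY p (b - i) f)).
Proof. by []. Qed.

Lemma shuffleXY_0r (F : numFieldType) p (f : nat -> F) : shuffleXY p 0 f = iter p opY f.
Proof.
elim: p => [|p IH]; first exact: opX0.
by rewrite shuffleXYS big_ord1 opX0 IH.
Qed.

(** The term [i = 0] of the definition collects the words beginning with y, the other terms those
    beginning with x. *)
Lemma shuffleXY_SS (F : numFieldType) p b (f : nat -> F) :
  shuffleXY p.+1 b.+1 f = opY (shuffleXY p b.+1 f) + opX 1 (shuffleXY p.+1 b f).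
Proof.
rewrite [in LHS]shuffleXYS big_ord_recl opX0 subn0; congr (_ + _).
rewrite /= linear_sum; apply: eq_bigr => i _.
by rewrite /bump add1n subSS opXS.
Qed.

(** The hockey-stick identity. *)
Lemma sum_bin_diag n k :
  (\sum_(i < n.+1) 'C(i + k, k) = 'C(n + k.+1, k.+1))%N.
Proof.
elim: n => [|n IHn]; first by rewrite big_ord1 !binn.
by rewrite big_ord_recr /= IHn [in RHS]addSn binS addSnnS.
Qed.

(** Words are sorted by the number [j1] of letters of y^j before the first y of the second word.
    After that y, the remaining [j - j1] and [k] letters y can be interleaved in C(j-j1+k, k)
    ways. *)
Lemma cauchyprod_powY_XpowY (F : numFieldType) j b k : cauchyprod (powY j) (opX b (powY k.+1)) =
  \sum_(j1 < j.+1) 'C(j - j1 + k, k)%:R *: shuffleXY j1 b (powY (j - j1 + k.+1))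
  :> (nat -> F).
Proof.
elim: j b => [|j IHj] b.
  by rewrite cauchyprod1s big_ord1 subn0 add0n binn scale1r.
elim: b => [|b IHb].
  rewrite opX0 cauchyprod_powY.
  under eq_bigr => j1 _.
    rewrite shuffleXY_0r /powY -iterD addnA subnKC ?leq_ord // -/(powY _).
    over.
  rewrite -scaler_suml -natr_sum; congr (_%:R *: _).
  rewrite (reindex_inj rev_ord_inj) /=.
  under eq_bigr => j1 _ do rewrite subSS subKn ?leq_ord //.
  by rewrite sum_bin_diag -bin_sub ?leq_addr // addKn.
rewrite opXS (cauchyprod_YX _ (powY j)) -?opXS; last exact: opX_at0 (powYS_at0 _ _).
rewrite IHj -/(powY j.+1) IHb.
(* The words with [j1 = 0] begin with x; the others split according to [shuffleXY_SS]. *)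
rewrite [in RHS]big_ord_recl [in X in _ + X]big_ord_recl.
rewrite !linearD /= addrCA; congr (_ + _).
  by rewrite linearZ /= -opXS.
rewrite !linear_sum -big_split /=; apply: eq_bigr => i _.
by rewrite !linearZ /= -scalerDr /bump add1n subSS shuffleXY_SS.
Qed.

(* The words of the shuffle product of [x^(b+1) y^j] and [y^k] in which some [y]
   of [y^k] precedes the last [x]; [t] counts the letters of [y^k] after it. *)
Definition shuffle_then_x (F : numFieldType) (j k b : nat) : nat -> F :=
  \sum_(t < k) 'C(j + t, j)%:R *: shuffleXY (k - t) b (opX 1 (powY (j + t))).
Arguments shuffle_then_x {F}.

(** A first letter y comes from y^(k+1). Removing it may leave no y of that word before the last x,
    whence the additional word x^(b+2) y^(j+k). *)
Lemma shuffle_then_xS (F : numFieldType) j k b : shuffle_then_x j k.+1 b.+1 =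
  opX 1 (shuffle_then_x j k.+1 b) + opY (shuffle_then_x j k b.+1 + 'C(j + k, j)%:R *: opX b.+2 (powY (j + k)))
  :> (nat -> F).
Proof.
rewrite /shuffle_then_x [in LHS]big_ord_recr [X in opX 1 X + _]big_ord_recr /=.
rewrite !linearD /= [RHS]addrACA; congr (_ + _).
  rewrite !linear_sum -big_split /=.
  apply: eq_bigr => i _; rewrite !linearZ /= -scalerDr.
  by rewrite subSn ?(ltnW (ltn_ord i)) // addrC -shuffleXY_SS.
rewrite !linearZ /= -scalerDr subSnn shuffleXY_SS addrC /=.
by rewrite shuffleXY0 -opXD addn1.
Qed.

(** With a single x, a word starting with x has no y before its last x, so only the first letter y
    remains. *)
Lemma shuffle_then_x0 (F : numFieldType) j k : shuffle_then_x j k.+1 0 =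
  opY (shuffle_then_x j k 0 + 'C(j + k, j)%:R *: opX 1 (powY (j + k))) :> (nat -> F).
Proof.
rewrite linearD /= /shuffle_then_x big_ord_recr /= linear_sum /= linearZ /=.
rewrite !subSnn !shuffleXY_0r /=; congr (_ + _).
apply: eq_bigr => i _; rewrite linearZ /= subSn ?(ltnW (ltn_ord i)) //.
by rewrite !shuffleXY_0r.
Qed.

(** The first term gathers the words in which no letter of y^k precedes the last x. *)
Lemma cauchyprod_XpowY_powY (F : numFieldType) j k m : (0 < j)%N ->
  cauchyprod (opX m.+1 (powY j)) (powY k) =
  'C(j + k, j)%:R *: opX m.+1 (powY (j + k)) + shuffle_then_x j k m :> (nat -> F).
Proof.
case: j => // j _; elim: k m => [|k IHk] m.
  by rewrite cauchyprodC cauchyprod1s addn0 binn scale1r /shuffle_then_x big_ord0 addr0.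
have E b : cauchyprod (opX b.+1 (powY j.+1)) (powY k.+1) =
    opY (cauchyprod (opX b.+1 (powY j.+1)) (powY k)) + opX 1 (cauchyprod (opX b (powY j.+1)) (powY k.+1)) :> (nat -> F).
  rewrite cauchyprodC opXS cauchyprod_YX -?opXS ?(cauchyprodC _ (powY k)) //; first by rewrite [in X in _ + X]cauchyprodC.
  exact: opX_at0 (powYS_at0 _ _).
elim: m => [|m IHm].
  rewrite E IHk shuffle_then_x0 opX0 cauchyprod_powY linearZ addrC [in X in opY X]addrC.
  by [].
rewrite E IHm IHk shuffle_then_xS [RHS]addrA addrC [opX 1 _]linearD /= linearZ /= -opXS.
by congr (_ + _); rewrite [in LHS]addrC.
Qed.

(** If the last x of the first word precedes the first y of the second, only letters x precede it:
    [m] from the first word and [n1] from the second, in C(m+n1, m) orders. Otherwise the last x of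
    the second word is preceded only by letters x, [m1] of them from the first word, in C(m1+n, n)
    orders. *)
Lemma cauchyprod_XY_XY (F : numFieldType) m n j k : (0 < j)%N -> (0 < k)%N ->
  cauchyprod (opX m.+1 (powY j)) (opX n.+1 (powY k)) =
    \sum_(n1 < n.+2) 'C(m + n1, m)%:R *: opX (m.+1 + n1) (cauchyprod (powY j) (opX (n.+1 - n1) (powY k)))
  + \sum_(m1 < m.+1) 'C(m1 + n, n)%:R *: opX (m1 + n.+1) (shuffle_then_x j k (m - m1))
  :> (nat -> F).
Proof.
move=> j0 k0.
(* The second argument of [A] is the number of letters x in the second word, so that [A m 0] can
   serve as a boundary value; in [B] it is one less. *)
pose A m n : nat -> F :=
  \sum_(n1 < n.+1) 'C(m + n1, m)%:R *: opX (m.+1 + n1) (cauchyprod (powY j) (opX (n - n1) (powY k))).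
pose B m n : nat -> F :=
  \sum_(m1 < m.+1) 'C(m1 + n, n)%:R *: opX (m1 + n.+1) (shuffle_then_x j k (m - m1)).
rewrite -/(A m n.+1) -/(B m n).
have Pj0 b : @opX F b (powY j) 0%N = 0 by apply: opX_at0; rewrite -(prednK j0) powYS_at0.
have Pk0 b : @opX F b (powY k) 0%N = 0 by apply: opX_at0; rewrite -(prednK k0) powYS_at0.
have E m' n' : cauchyprod (opX m'.+1 (powY j)) (opX n'.+1 (powY k)) =
    opX 1 (cauchyprod (opX m' (powY j)) (opX n'.+1 (powY k)))
  + opX 1 (cauchyprod (opX m'.+1 (powY j)) (opX n' (powY k))) :> (nat -> F).
  by rewrite !(opXS _ m') !(opXS _ n') cauchyprod_XX // -!opXS.
(* Pascal's rule makes [A] and [B] obey the recursion [E], with corrections where an argument is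
   0. *)
have A0 n' : A 0 n'.+1 = opX 1 (cauchyprod (powY j) (opX n'.+1 (powY k))) + opX 1 (A 0 n').
  rewrite /A big_ord_recl add0n bin0 scale1r subn0 addn0 linear_sum /=; congr (_ + _).
  apply: eq_bigr => i _; rewrite !bin0 !scale1r /bump add1n subSS -opXS.
  by [].
have AS m' n' : A m'.+1 n'.+1 = opX 1 (A m' n'.+1) + opX 1 (A m'.+1 n').
  rewrite /A !linear_sum /= big_ord_recl /= [in RHS]big_ord_recl /= -addrA !addn0 !subn0 !binn.
  rewrite !scale1r -opXS; congr (_ + _); rewrite -big_split /=; apply: eq_bigr => i _.
  rewrite /bump add1n subSS !linearZ /= -!opXS -(addnS m'.+2 i) -(addSn m'.+1 i.+1).
  by rewrite -scalerDl -natrD (addSnnS m' i) (addSn m' i.+1) binS addnC.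
have B0 m' : B m'.+1 0 = opX 1 (shuffle_then_x j k m'.+1) + opX 1 (B m' 0).
  rewrite /B big_ord_recl [X in _ = _ + X]linear_sum /= bin0 scale1r subn0; congr (_ + _).
  apply: eq_bigr => i _; rewrite !bin0 !scale1r /bump add1n subSS.
  by rewrite addSn opXS.
have BS m' n' : B m'.+1 n'.+1 = opX 1 (B m' n'.+1) + opX 1 (B m'.+1 n').
  rewrite /B !linear_sum /= addrC big_ord_recl /= [in RHS]big_ord_recl /= -addrA !add0n !subn0 !binn.
  rewrite !scale1r -opXS; congr (_ + _); rewrite -big_split /=; apply: eq_bigr => i _.
  rewrite /bump add1n subSS !linearZ /= -!opXS -(addnS i.+1 n'.+1) -(addSn i n'.+2).
  by rewrite -scalerDl -natrD (addSnnS i n') (addSn i n'.+1) binS addnC.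
have Q m' : cauchyprod (opX m'.+1 (powY j)) (opX 0 (powY k)) = A m' 0%N + shuffle_then_x j k m'.
  rewrite opX0 cauchyprod_XpowY_powY // /A big_ord1 addn0 binn scale1r subnn opX0 cauchyprod_powY.
  by rewrite [in RHS]addn0 linearZ.
have B0S n' : B 0%N n'.+1 = opX 1 (B 0%N n').
  by rewrite /B !big_ord1 !add0n !binn !scale1r -opXS.
elim: m n => [|m IHm]; elim=> [|n IHn].
- rewrite E Q opX0 A0 linearD /= addrA; congr (_ + _).
  by rewrite /B big_ord1 add0n binn scale1r.
- by rewrite E opX0 IHn (A0 n.+1) (B0S n) linearD /= addrA.
- by rewrite E IHm Q (AS m 0%N) (B0 m) !linearD /= addrACA; congr (_ + _); rewrite addrC.
- by rewrite E IHm IHn (AS m n.+1) (BS m n) !linearD /= addrACA.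
Qed.

(** * Sums of nonnegative sequences and convergence *)

Definition has_sum (R : realType) (f : nat -> R) (v : R) : Prop :=
  (forall N, 0 <= f N) /\ (\esum_(N in [set: nat]) (f N)%:E = v%:E)%E.
Arguments has_sum {R}.

Lemma has_sum_unique (R : realType) (f : nat -> R) v w :
  has_sum f v -> has_sum f w -> v = w.
Proof. by move=> [_ fv] [_ fw]; apply: EFin_inj; rewrite -fv -fw. Qed.

Lemma has_sum0 (R : realType) : has_sum (0 : nat -> R) 0.
Proof. by split=> // ; rewrite esum1. Qed.

Lemma has_sumD (R : realType) (f g : nat -> R) v w :
  has_sum f v -> has_sum g w -> has_sum (f + g) (v + w).
Proof.
move=> [f0 fv] [g0 gw]; split=> [N|]; first by rewrite fctE addr_ge0.
under eq_esum do rewrite fctE EFinD.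
by rewrite esumD ?fv ?gw // => i _; rewrite lee_fin.
Qed.

Lemma has_sum_sum (R : realType) (I : Type) (r : seq I) (P : pred I)
    (f : I -> nat -> R) (v : I -> R) :
  (forall i, P i -> has_sum (f i) (v i)) ->
  has_sum (\sum_(i <- r | P i) f i) (\sum_(i <- r | P i) v i).
Proof.
move=> fv; elim/big_rec2: _ => [|i w g Pi gw]; first exact: has_sum0.
exact: has_sumD (fv i Pi) gw.
Qed.

Lemma has_sumZ (R : realType) (c : R) (f : nat -> R) v :
  0 <= c -> has_sum f v -> has_sum (c *: f) (c * v).
Proof.
move=> c0 [f0 fv]; split=> [N|]; first by rewrite fctE mulr_ge0.
rewrite -nneseries_esumT => [|N]; last by rewrite lee_fin fctE mulr_ge0.
under eq_eseriesr do rewrite fctE EFinM.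
rewrite nneseriesZl => [|N _]; last by rewrite lee_fin.
by rewrite nneseries_esumT ?fv // => N; rewrite lee_fin.
Qed.

Lemma esum_ord (R : realType) n (a : nat -> R) : (forall i, 0 <= a i) ->
  (\esum_(i in `I_n) (a i)%:E = (\sum_(i < n) a i)%:E)%E.
Proof.
move=> a0; rewrite -sumEFin (fsbig_ord _ _ (fun i => (a i)%:E)).
by rewrite -esum_fset // => i _; rewrite lee_fin.
Qed.

(** Tonelli for nonnegative terms: the pairs (N, i) with i <= N are reindexed by (i, j) -> (i + j,
    i). *)
Lemma has_sum_cauchyprod (R : realType) (f g : nat -> R) v w :
  has_sum f v -> has_sum g w -> has_sum (cauchyprod f g) (v * w).
Proof.
move=> [f0 fv] [g0 gw]; split=> [N|].
  by apply: sumr_ge0 => i _; rewrite mulr_ge0.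
have fg0 i j : (0 <= (f i * g j)%:E)%E by rewrite lee_fin mulr_ge0.
transitivity (\esum_(N in [set: nat]) \esum_(i in `I_N.+1) (f i * g (N - i)%N)%:E)%E.
  apply: eq_esum => N _.
  by rewrite (esum_ord _ _ (fun i => f i * g (N - i)%N)) // => i; rewrite mulr_ge0.
rewrite esum_esum //.
rewrite (reindex_esum [set: nat * nat] _ (fun p => (p.1 + p.2, p.1)%N)); last first.
  split=> /=.
  - by move=> [i j] _ /=; split=> //; rewrite /= ltnS leq_addr.
  - by move=> [i j] [i' j'] _ _ /= [+ e]; rewrite e => /addnI ->.
  - move=> [N i] [_ /= iN]; exists (i, (N - i)%N) => //=.
    by rewrite subnKC ?leq_ord.
transitivity (\esum_(i in [set: nat]) \esum_(j in [set: nat]) (f i * g j)%:E)%E.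
  rewrite esum_esum //; apply: congr2 => //.
    by apply/seteqP; split.
  by apply/funext => -[i j] /=; rewrite addKn.
transitivity (\esum_(i in [set: nat]) (w%:E * (f i)%:E))%E.
  apply: eq_esum => i _; rewrite -nneseries_esumT //.
  under eq_eseriesr do rewrite EFinM.
  rewrite nneseriesZl => [|N _]; last by rewrite lee_fin.
  by rewrite nneseries_esumT ?gw 1?muleC // => N; rewrite lee_fin.
rewrite -nneseries_esumT => [|N]; last first.
  rewrite -EFinM lee_fin mulr_ge0 // -lee_fin -gw.
  by apply: esum_ge0 => ? _; rewrite lee_fin.
rewrite nneseriesZl => [|N _]; last by rewrite lee_fin.
by rewrite nneseries_esumT ?fv 1?EFinM 1?muleC // => N; rewrite lee_fin.
Qed.

(* A square-root decay, unlike a harmonic one, is preserved by [opY]. *)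
Definition tame (R : realType) (f : nat -> R) : Prop :=
  (forall N, 0 <= f N) /\
  exists2 C : R, 0 <= C & forall N, f N.+1 <= C / Num.sqrt N.+1%:R.
Arguments tame {R}.

Lemma tame_unit_coef (R : realType) : tame (@unit_coef R).
Proof. by split=> [N|]; [rewrite ler0n | exists 0 => // N; rewrite mul0r]. Qed.

Lemma tame_opX (R : realType) i (f : nat -> R) : tame f -> tame (opX i f).
Proof.
move=> [f0 [C C0 fC]]; split=> [N|]; first by rewrite divr_ge0 ?exprn_ge0.
exists C => // N; apply: le_trans (fC N); rewrite /opX.
by rewrite ler_pdivrMr ?exprn_gt0 ?ltr0n // ler_peMr // exprn_ege1 // ler1n.
Qed.

(** Telescoping bound for the partial sums of 1/sqrt N, from (b - a)(b + a) = 1 for consecutive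
    square roots a < b. *)
Lemma sqrt_step_lower (R : realType) N :
  (Num.sqrt N.+1%:R)^-1 <= 2 * (Num.sqrt N.+1%:R - Num.sqrt N%:R) :> R.
Proof.
have b0 : 0 < Num.sqrt (N.+1%:R : R) by rewrite sqrtr_gt0 ltr0n.
have := sqr_sqrtr (ler0n R N.+1); rewrite -natr1 -{2}(sqr_sqrtr (ler0n R N)) natr1.
have := sqrtr_ge0 (N%:R : R); move: b0.
move: (Num.sqrt N%:R) (Num.sqrt N.+1%:R) => a b b0 a0 ab.
by rewrite -[leLHS]mul1r ler_pdivrMr //; nra.
Qed.

(** Telescoping bound for the sum of N^(-3/2). *)
Lemma sqrt_step_upper (R : realType) N :
  (N.+2%:R * Num.sqrt N.+2%:R)^-1
    <= 2 / Num.sqrt N.+1%:R - 2 / Num.sqrt N.+2%:R :> R.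
Proof.
have a0 : 0 < Num.sqrt (N.+1%:R : R) by rewrite sqrtr_gt0 ltr0n.
have b0 : 0 < Num.sqrt (N.+2%:R : R) by rewrite sqrtr_gt0 ltr0n.
rewrite -{1}(sqr_sqrtr (ler0n R N.+2)).
have := sqr_sqrtr (ler0n R N.+2); rewrite -natr1 -{2}(sqr_sqrtr (ler0n R N.+1)) natr1.
move: a0 b0; move: (Num.sqrt N.+1%:R) (Num.sqrt N.+2%:R) => a b a0 b0 ab.
have -> : 2 / a - 2 / b = 2 * b ^+ 2 * (b - a) / (a * b ^+ 3).
  by field; rewrite !gt_eqF.
rewrite -[leLHS]mul1r ler_pdivrMr ?mulr_gt0 ?exprn_gt0 //.
have -> : 2 * b ^+ 2 * (b - a) / (a * b ^+ 3) * (b ^+ 2 * b) = 2 * b ^+ 2 * (b - a) / a.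
  by field; rewrite !gt_eqF.
rewrite ler_pdivlMr // mul1r.
(* Multiplied by a + b, the goal becomes a (a + b) <= 2 b^2. *)
have : (b - a) * (b + a) = 1 by rewrite -subr_sqr ab addrC addKr.
have : a <= b by nra.
nra.
Qed.

(** Partial sums of a sequence O(1/sqrt N) are O(sqrt N), and division by N restores the decay. *)
Lemma tame_opY (R : realType) (f : nat -> R) : tame f -> tame (opY f).
Proof.
move=> [f0 [C C0 fC]]; split=> [N|]; first by rewrite divr_ge0 ?sumr_ge0.
(* [f 0] escapes the decay bound and is added apart; [2 * C] comes from [sqrt_step_lower]. *)
pose D := f 0%N + 2 * C.
have D0 : 0 <= D by rewrite addr_ge0 ?mulr_ge0.
exists D => // N.
have psum_le : psum f N.+1 <= f 0%N + 2 * C * Num.sqrt N%:R.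
  elim: N => [|N IH]; first by rewrite /psum big_ord1 sqrtr0 mulr0 addr0.
  rewrite /psum big_ord_recr /= -/(psum f N.+1).
  apply: le_trans (lerD IH (fC N)) _; rewrite -addrA lerD2l addrC -lerBrDr -mulrBr.
  by rewrite (mulrC 2) -!mulrA ler_wpM2l // sqrt_step_lower.
have sqN_ge1 : 1 <= Num.sqrt (N.+1%:R : R) by rewrite -[leLHS]sqrtr1 ler_sqrt ?ler1n.
have sqN_le : Num.sqrt (N%:R : R) <= Num.sqrt N.+1%:R by rewrite ler_sqrt ?ler_nat.
suff psumD : psum f N.+1 <= D * Num.sqrt N.+1%:R.
  rewrite /opY ler_pdivrMr ?ltr0n // -[X in _ * X](@sqr_sqrtr _ N.+1%:R) ?ler0n //.
  by rewrite expr2 mulrA divfK // gt_eqF // (lt_le_trans ltr01).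
apply: le_trans psum_le _; rewrite /D (mulrDl (f 0%N)); apply: lerD; last by rewrite ler_wpM2l ?mulr_ge0.
by rewrite ler_peMr.
Qed.

(** A division by N improves O(1/sqrt N) to the summable O(N^(-3/2)), so the sum is finite and
    [fine] returns it. *)
Lemma tame_has_sum (R : realType) i (f : nat -> R) : tame f ->
  has_sum (opX i.+1 f) (fine (\esum_(N in [set: nat]) (opX i.+1 f N)%:E)%E).
Proof.
move=> ft; have [g0 _] := tame_opX _ i.+1 _ ft; split=> //.
rewrite fineK //; have [f0 [C C0 fC]] := ft.
(* The term of index 0 vanishes because the inverse of 0 is 0. The term of index 1 is at most [C],
   and the later ones telescope to at most [2 * C], whence the 3. *)
have bnd M : \sum_(N < M.+2) opX i.+1 f N <= C * (3 - 2 / Num.sqrt M.+1%:R).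
  have opXC N : opX i.+1 f N.+1 <= C / (N.+1%:R * Num.sqrt N.+1%:R).
    rewrite /opX [in leRHS]invfM [in leRHS](mulrC _^-1) mulrA.
    apply: ler_pM; rewrite ?invr_ge0 ?exprn_ge0 //.
    by rewrite lef_pV2 ?posrE ?exprn_gt0 ?ltr0n // exprS ler_peMr // exprn_ege1 // ler1n.
  elim: M => [|M IH].
    rewrite big_ord_recr big_ord1 /= {1}/opX exprS mul0r invr0 mulr0 add0r.
    by apply: le_trans (opXC _) _; rewrite sqrtr1 !divr1 mulr1; lra.
  rewrite big_ord_recr /=; apply: le_trans (lerD IH (opXC _)) _.
  rewrite -mulrDr ler_wpM2l //.
  by rewrite -addrA lerD2l addrC lerBlDr addrC sqrt_step_upper.
rewrite ge0_fin_numE; last by apply: esum_ge0 => N _; rewrite lee_fin.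
apply: (@le_lt_trans _ _ (3 * C)%:E); last exact: ltry.
rewrite -nneseries_esumT => [|N]; last by rewrite lee_fin.
apply: lime_le; first by apply: is_cvg_nneseries => N _ _; rewrite lee_fin.
apply: nearW => M; rewrite sumEFin lee_fin big_mkord.
case: M => [|[|M]].
- by rewrite big_ord0 mulr_ge0.
- by rewrite big_ord1 /opX exprS mul0r invr0 mulr0 mulr_ge0.
- apply: le_trans (bnd M) _; rewrite mulrC ler_wpM2r // gerBl divr_ge0 // sqrtr_ge0.
Qed.

(** * Multiple zeta values as sums of coefficients *)

Definition mzv_coef (F : numFieldType) (s : seq nat) : nat -> F :=
  foldr (fun a f => opX a.-1 (opY f)) unit_coef s.
Arguments mzv_coef {F} s : simpl never.

Lemma mzv_coefS (F : numFieldType) a s :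
  mzv_coef (a :: s) = opX a.-1 (opY (mzv_coef s)) :> (nat -> F).
Proof. by []. Qed.

(** This is the coefficient of t^N in a multiple polylogarithm: the largest index is [N], and [psum]
    lets the next one run below it. *)
Lemma mzv_coef_cons (F : numFieldType) a s : (0 < a)%N ->
  mzv_coef (a :: s) = fun N => (N%:R ^+ a)^-1 * psum (mzv_coef s) N :> F.
Proof.
case: a => // a _; apply/funext => N; rewrite /mzv_coef /=.
by rewrite /opX /opY exprS invfM [RHS]mulrC mulrA.
Qed.

Lemma tame_mzv_coef (R : realType) s : tame (@mzv_coef R s).
Proof.
elim: s => [|a s IHs]; first exact: tame_unit_coef.
exact: tame_opX (tame_opY _ _ IHs).
Qed.

Definition chains (p N : nat) : set (p.-tuple nat) :=
  [set n : p.-tuple nat | path gtn N n /\ all (leq 1) n].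

(** Splits off the largest index [M]. The set [P] allowed for it is [I_N] in the induction on [s]
    and everything for the full zeta value; [c] carries the factors already split off. *)
Lemma esum_cons_chains (R : realType) a s (c : R)
    (P : set nat) (Q : set ((size s).+1.-tuple nat)) :
  0 <= c -> (0 < a)%N ->
  (forall M t, Q (cons_tuple M t) <-> (P M /\ (0 < M)%N) /\ chains (size s) M t) ->
  (forall (d : R) M, 0 <= d -> (0 < M)%N ->
    (\esum_(n in chains (size s) M)
      (d * \prod_(i < size s) ((nth 0%N n i)%:R ^+ nth 0%N s i)^-1)%:E
     = (d * psum (mzv_coef s) M)%:E)%E) ->
  (\esum_(n in Q)
      (c * \prod_(i < (size s).+1) ((nth 0%N n i)%:R ^+ nth 0%N (a :: s) i)^-1)%:E
   = \esum_(M in P) (c * mzv_coef (a :: s) M)%:E)%E.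
Proof.
move=> c0 a0 QP IH.
rewrite (reindex_esum ((P `&` [set M | (0 < M)%N])%classic `*`` chains (size s)) _
    (fun q => cons_tuple q.1 q.2)); last first.
  split=> /=.
  - by move=> [M t] /= [PM Mt]; apply/QP.
  - by move=> [M t] [M' t'] _ _ /= /(congr1 val) /= [-> /val_inj ->].
  - move=> n Qn; have nE : cons_tuple (thead n) (behead_tuple n) = n.
      by rewrite [RHS]tuple_eta; apply: val_inj.
    by exists (thead n, behead_tuple n) => //=; apply/QP; rewrite nE.
rewrite -(esum_esum (a := fun M (t : (size s).-tuple nat) =>
    (c * \prod_(i < (size s).+1) ((nth 0%N (M :: t) i)%:R ^+ nth 0%N (a :: s) i)^-1)%:E)); last first.
  move=> M t _ _; rewrite lee_fin mulr_ge0 // prodr_ge0 //.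
rewrite esum_mkcondr; apply: eq_esum => M _.
case: ifPn => [|/negP]; rewrite inE /= => M0; last first.
  (* No chain has largest index 0, and on the other side the empty [psum] gives 0 there. *)
  have -> : M = 0%N by case: M M0.
  by rewrite mzv_coef_cons // /psum big_ord0 !mulr0.
rewrite mzv_coef_cons // mulrA -IH //; last by rewrite mulr_ge0 // invr_ge0 exprn_ge0.
by apply: eq_esum => t _; rewrite big_ord_recl /= mulrA.
Qed.

Lemma esum_chains (R : realType) s (c : R) N :
  all (leq 1) s -> 0 <= c -> (0 < N)%N ->
  (\esum_(n in chains (size s) N)
      (c * \prod_(i < size s) ((nth 0%N n i)%:R ^+ nth 0%N s i)^-1)%:E
     = (c * psum (mzv_coef s) N)%:E)%E.
Proof.
elim: s c N => [|a s IHs] c N /=.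
  move=> _ c0 N0; rewrite (_ : chains 0 N = [set [tuple]]%classic).
    rewrite esum_set1 ?lee_fin big_ord0 mulr1 //.
    by case: N N0 => // N _; rewrite /psum big_ord_recl big1 ?addr0 ?mulr1.
  by apply/seteqP; split=> t; rewrite (tuple0 t).
move=> /andP[a0 sP] c0 N0.
rewrite (esum_cons_chains _ a s c `I_N) //.
- rewrite (esum_ord _ _ (fun M => c * mzv_coef (a :: s) M)) => [|M].
    by rewrite -mulr_sumr.
  by rewrite mulr_ge0 //; have [] := tame_mzv_coef R (a :: s).
- move=> M t; rewrite /chains /=; split.
    by move=> [/andP[MN Mt] /andP[M0 tP]].
  by move=> [[MN M0] [Mt tP]]; split; apply/andP.
- by move=> d M d0 M0; apply: IHs.
Qed.

Lemma mzvE (R : realType) a s : (0 < a)%N -> all (leq 1) s ->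
  mzv R (a :: s) = fine (\esum_(N in [set: nat]) (mzv_coef (a :: s) N)%:E)%E.
Proof.
move=> a0 sP; rewrite /mzv; congr fine.
transitivity (\esum_(N in [set: nat]) (1 * @mzv_coef R (a :: s) N)%:E)%E; last first.
  by apply: eq_esum => N _; rewrite mul1r.
rewrite -(esum_cons_chains _ a s 1 setT
  [set n : (size s).+1.-tuple nat | sorted gtn n /\ all (leq 1) n]) //.
- by apply: eq_esum => n _; rewrite mul1r.
- move=> M t; rewrite /chains /=; split.
    by move=> [Mt /andP[M0 tP]].
  by move=> [[_ M0] [Mt tP]]; split=> //; apply/andP.
- by move=> d M d0 M0; apply: esum_chains.
Qed.

(** A first entry of at least 2 makes x the outermost letter, which supplies the division needed for
    convergence. *)
Lemma has_sum_mzv (R : realType) a s : (1 < a)%N -> all (leq 1) s ->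
  has_sum (mzv_coef (a :: s)) (mzv R (a :: s)).
Proof.
case: a => [|[|a]] // _ sP; rewrite mzvE //.
exact: tame_has_sum (tame_opY _ _ (tame_mzv_coef _ s)).
Qed.

(* [compX f (a_1, ..., a_p)] is the word x^(a_1-1) y x^(a_2-1) y ... y x^(a_p-1)
   applied to [f]. *)
Fixpoint compX (F : numFieldType) (f : nat -> F) (s : seq nat) : nat -> F :=
  if s is a :: s' then opX a.-1 (if s' is [::] then f else opY (compX F f s'))
  else f.
Arguments compX {F}.

Lemma compX_cons (F : numFieldType) (f : nat -> F) a s : s != [::] ->
  compX f (a :: s) = opX a.-1 (opY (compX f s)).
Proof. by case: s. Qed.

(** * Sums over compositions as shuffle products *)

Lemma sum_tuple_cons (V : nmodType) (T : finType) p (P : pred (seq T)) (H : seq T -> V) :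
  \sum_(a : p.+1.-tuple T | P a) H a =
  \sum_(x : T) \sum_(t : p.-tuple T | P (x :: t)) H (x :: t).
Proof.
rewrite pair_big_dep /=.
rewrite (reindex (fun q : T * p.-tuple T => cons_tuple q.1 q.2)) //=.
exists (fun a : p.+1.-tuple T => (thead a, behead_tuple a)) => [[x t]|a] _ /=.
  by congr pair; apply: val_inj.
by rewrite [RHS]tuple_eta; apply: val_inj.
Qed.

(** A word in the shuffle of x^(w-p-1) and y^p is determined by its p + 1 runs of x, of lengths a_i
    - 1. The bound [W] is kept apart from [w] so that removing the first entry lowers [w] without
    changing the type of the entries. *)
Lemma sum_compX (F : numFieldType) (f : nat -> F) W p w : (w <= W)%N ->
  \sum_(a : p.+1.-tuple 'I_W.+1 |
      all (leq 1) (map val a) && (sumn (map val a) == w)) compX f (map val a)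
  = if (p < w)%N then shuffleXY p (w - p.+1) f else 0.
Proof.
move=> wW; pose P w := fun s : seq 'I_W.+1 => all (leq 1) (map val s) && (sumn (map val s) == w).
elim: p w wW => [|p IHp] w wW;
  rewrite (sum_tuple_cons _ _ _ (P w) (fun s => compX f (map val s))).
  have tuple0E : xpredT =1 pred1 ([tuple] : 0.-tuple 'I_W.+1).
    by move=> t; apply/esym/eqP; exact: tuple0.
  under eq_bigr => x _ do rewrite big_mkcond (big_pred1 _ tuple0E) /P /= andbT addn0.
  rewrite -big_mkcond /=; case: ifPn => w0; last first.
    rewrite big_pred0 // => x; move: w0; case: (w) => // _.
    by case: (val x).
  rewrite (big_pred1 (Ordinal (wW : (w < W.+1)%N))) /= ?subn1 // => x.
  by rewrite /= -[RHS]val_eqE /=; case: eqP => [->|]; rewrite ?andbF ?andbT.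
(* [G x] is the contribution of the first entry [x]; it is 0 if the rest admits no composition. *)
pose G (x : nat) := if ((0 < x <= w) && (p < w - x))%N then
  opX x.-1 (opY (shuffleXY p (w - x - p.+1) f)) else 0.
transitivity (\sum_(x < W.+1) G x).
  apply: eq_bigr => x _; rewrite /G.
  have [xw|xw] := boolP (0 < x <= w)%N; last first.
    rewrite big_pred0 // => t; apply/negP => /andP[/= /andP[x0 _] /eqP e].
    by move: xw; rewrite x0 -e leq_addr.
  have [x0 xlew] := andP xw.
  transitivity (\sum_(t : p.+1.-tuple 'I_W.+1 | P (w - x)%N t)
      opX x.-1 (opY (compX f (map val t)))).
    apply: eq_big => [t|t _].
      by rewrite /P /= x0 /=; congr (_ && _); rewrite -[in RHS](eqn_add2l x) subnKC.
    by rewrite map_cons compX_cons // -size_eq0 size_map size_tuple.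
  rewrite -!linear_sum /= IHp; last by rewrite (leq_trans (leq_subr _ _)).
  by case: ifP => //; rewrite !linear0.
rewrite big_ord_recl add0r.
case: ifPn => pw; last first.
  rewrite big1 // => i _; rewrite /G lift0; case: ifP => // h; exfalso; lia.
transitivity (\sum_(i < W | (i < (w - p.+2).+1)%N) opX i (opY (shuffleXY p (w - p.+2 - i) f))).
  rewrite [RHS]big_mkcond; apply: eq_bigr => i _; rewrite /G lift0.
  have -> : ((0 < i.+1 <= w) && (p < w - i.+1) = (i < (w - p.+2).+1))%N by lia.
  by have -> : (w - i.+1 - p.+1 = w - p.+2 - i)%N by lia.
rewrite shuffleXYS [RHS](big_ord_widen W (fun i => opX i (opY (shuffleXY p (w - p.+2 - i) f)))) //.
by lia.
Qed.

(** The equations for [q] and [w] absorb the various forms in which these numbers occur in tuple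
    types. *)
Lemma sum_is_comp (F : numFieldType) (f : nat -> F) p q w b :
  q = p.+1 -> w = (b + p.+1)%N ->
  \sum_(a : q.-tuple 'I_w.+1 | is_comp a) compX f (map val a) = shuffleXY p b f.
Proof.
move=> -> wE; have := sum_compX F f w p w (leqnn w).
rewrite wE addnS ltnS leq_addl -addnS addnK => <-.
rewrite -wE; apply: eq_bigl => a; rewrite /is_comp; congr (_ && _).
  rewrite all_map; apply/forallP/all_tnthP => aP i; exact: aP.
by rewrite sumnE big_map big_tuple.
Qed.

(** * The words of the indices in the two sums *)

Lemma mzv_coef_addl (F : numFieldType) e a s : (0 < a)%N ->
  mzv_coef (a + e :: s) = opX e (mzv_coef (a :: s)) :> (nat -> F).
Proof. by case: a => // a _; rewrite /mzv_coef /= addnC opXD. Qed.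

Lemma mzv_coef_nseq1 (F : numFieldType) c : mzv_coef (nseq c 1%N) = powY c :> (nat -> F).
Proof. by elim: c => // c IH; rewrite mzv_coefS opX0 IH. Qed.

(** The y that closes the last entry of [s] joins the [c] letters of the ones, hence [c.+1]. *)
Lemma mzv_coef_cat_nseq1 (F : numFieldType) s c : s != [::] ->
  mzv_coef (s ++ nseq c 1%N) = compX (powY c.+1) s :> (nat -> F).
Proof.
elim: s => // a s IH _; rewrite cat_cons mzv_coefS.
case: s IH => [_|a' s IH]; first by rewrite mzv_coef_nseq1.
by rewrite IH.
Qed.

(** The increment of the last entry is the x just before the final block of y. *)
Lemma mzv_coef_rcons_nseq1 (F : numFieldType) s a c : (0 < a)%N ->
  mzv_coef (s ++ (a + 1)%N :: nseq c 1%N) = compX (opX 1 (powY c.+1)) (rcons s a)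
  :> (nat -> F).
Proof.
move=> a0; elim: s => [|b s IH].
  by rewrite mzv_coefS mzv_coef_nseq1 -(prednK a0) addn1 /= -opXD addn1.
by rewrite rcons_cons compX_cons -?IH //; case: (s).
Qed.

Lemma is_comp_gt0 (p w : nat) (a : p.-tuple 'I_w.+1) :
  is_comp a -> all (leq 1) (map val a).
Proof.
move=> /andP[/forallP aP _]; rewrite all_map; apply/all_tnthP => i.
exact: aP.
Qed.

Lemma entry_iota2 (p w : nat) (a : p.-tuple 'I_w.+1) l : (l < p)%N ->
  [seq entry a i | i <- iota 2 l] = take l (behead (map val a)).
Proof.
move=> lp; rewrite -[2%N]addn0 iotaDl -map_comp -(map_nth_iota0 0%N).
  by apply: eq_map => i; rewrite nth_behead.
by rewrite size_behead size_map size_tuple -ltnS (ltn_predK lp).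
Qed.

Lemma mzv_coef_first_index (F : numFieldType) m n1 j1 c q w (a : q.-tuple 'I_w.+1) :
  q = j1.+1 -> is_comp a ->
  mzv_coef (first_index m n1 j1 c (entry a)) =
  opX (m + n1) (compX (powY c.+1) (map val a)) :> (nat -> F).
Proof.
move=> qE /is_comp_gt0; rewrite /first_index /index_iota !subSS subn0.
rewrite entry_iota2 ?qE // /entry.
have : size (map val a) = j1.+1 by rewrite size_map size_tuple qE.
case: (map val a) => //= x s [<-] /andP[x0 _].
by rewrite take_size -addnA mzv_coef_addl // -cat_cons mzv_coef_cat_nseq1.
Qed.

Lemma mzv_coef_second_index (F : numFieldType) m1 n d c q w (a : q.-tuple 'I_w.+1) :
  (0 < d)%N -> q = d.+1 -> is_comp a ->
  mzv_coef (second_index m1 n d c (entry a)) =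
  opX (m1 + n) (compX (opX 1 (powY c.+1)) (map val a)) :> (nat -> F).
Proof.
case: d => // d _ qE /is_comp_gt0; rewrite /second_index /index_iota !subSS subn0.
rewrite entry_iota2 ?qE // /entry.
have : size (map val a) = d.+2 by rewrite size_map size_tuple qE.
case: (map val a) => //= x s [sd] /andP[x0 sP].
have s_last : rcons (take d s) (nth 0%N s d) = s.
  by rewrite -take_nth ?sd // -sd take_size.
rewrite -addnA mzv_coef_addl // -cat_cons mzv_coef_rcons_nseq1.
  by rewrite rcons_cons s_last.
by apply: (allP sP); rewrite mem_nth ?sd.
Qed.

Lemma all_first_index m n1 j1 c q w (a : q.-tuple 'I_w.+1) : (0 < m)%N ->
  q = j1.+1 -> is_comp a ->
  exists2 x, (1 < x)%N & exists2 s, all (leq 1) s & first_index m n1 j1 c (entry a) = x :: s.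
Proof.
move=> m0 qE /is_comp_gt0; rewrite /first_index /index_iota !subSS subn0.
rewrite entry_iota2 ?qE // /entry.
have : size (map val a) = j1.+1 by rewrite size_map size_tuple qE.
case: (map val a) => //= x s [<-] /andP[x0 sP].
eexists; last by eexists; last reflexivity; rewrite take_size all_cat sP all_nseq orbT.
by lia.
Qed.

Lemma all_second_index m1 n d c q w (a : q.-tuple 'I_w.+1) : (0 < n)%N ->
  (0 < d)%N -> q = d.+1 -> is_comp a ->
  exists2 x, (1 < x)%N & exists2 s, all (leq 1) s & second_index m1 n d c (entry a) = x :: s.
Proof.
move=> n0; case: d => // d _ qE /is_comp_gt0; rewrite /second_index /index_iota !subSS subn0.
rewrite entry_iota2 ?qE // /entry.
have : size (map val a) = d.+2 by rewrite size_map size_tuple qE.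
case: (map val a) => //= x s [sd] /andP[x0 sP].
eexists; last first.
  eexists; last reflexivity.
  rewrite all_cat /= addn1 all_nseq orbT !andbT.
  by apply/allP => y /mem_take; exact: (allP sP).
by lia.
Qed.

Lemma has_sum_first_index (R : realType) m n1 j1 c q w (a : q.-tuple 'I_w.+1) :
  (0 < m)%N -> q = j1.+1 -> is_comp a ->
  has_sum (opX (m + n1) (compX (powY c.+1) (map val a)))
    (mzv R (first_index m n1 j1 c (entry a))).
Proof.
move=> m0 qE ac; rewrite -(mzv_coef_first_index _ m n1 j1) //.
by have [x x1 [s sP ->]] := all_first_index m n1 j1 c _ _ a m0 qE ac; apply: has_sum_mzv.
Qed.

Lemma has_sum_second_index (R : realType) m1 n d c q w (a : q.-tuple 'I_w.+1) :
  (0 < n)%N -> (0 < d)%N -> q = d.+1 -> is_comp a ->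
  has_sum (opX (m1 + n) (compX (opX 1 (powY c.+1)) (map val a)))
    (mzv R (second_index m1 n d c (entry a))).
Proof.
move=> n0 d0 qE ac; rewrite -(mzv_coef_second_index _ m1 n d) //.
by have [x x1 [s sP ->]] := all_second_index m1 n d c _ _ a n0 d0 qE ac; apply: has_sum_mzv.
Qed.

(** Serves for [j2] and [m2], which are determined by [j1] and [m1]. *)
Lemma sum_add_eq (V : nmodType) N n (F : nat -> V) (i : nat) : (i <= n < N)%N ->
  \sum_(j < N | (i + j == n)%N) F j = F (n - i)%N.
Proof.
move=> /andP[ile nN].
rewrite (big_pred1 (Ordinal (leq_ltn_trans (leq_subr i n) nN))) // => j.
by rewrite /= -[RHS]val_eqE /= -[RHS](eqn_add2l i) subnKC.
Qed.

(** * Assembly of the product formula *)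

Theorem theorem1p1 (R : realType) (m n j k : nat)
    (hm : (0 < m)%N) (hn : (0 < n)%N) (hj : (0 < j)%N) (hk : (0 < k)%N) :
  mzv R ((m + 1)%N :: nseq (j - 1) 1%N) * mzv R ((n + 1)%N :: nseq (k - 1) 1%N)
  = \sum_(n1 < n.+1) \sum_(j1 < j.+1) \sum_(j2 < j.+1 | (j1 + j2 == j)%N)
      \sum_(a : (j1 + 1).-tuple 'I_(n - n1 + j1 + 1).+1 | is_comp a)
        'C(m - 1 + n1, m - 1)%:R * 'C(j2 + k - 1, k - 1)%:R
        * mzv R (first_index m n1 j1 (j2 + k - 1) (entry a))
  + \sum_(t < k) \sum_(m1 < m) \sum_(m2 < m | (m1 + m2 == m - 1)%N)
      \sum_(b : (k - t + 1).-tuple 'I_(m2 + (k - t) + 1).+1 | is_comp b)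
        'C(m1 + n - 1, n - 1)%:R * 'C(j + t, j)%:R
        * mzv R (second_index m1 n (k - t) (j + t - 1) (entry b)).
Proof.
have lhs p q : (0 < p)%N -> (0 < q)%N ->
    has_sum (opX p (powY q)) (mzv R ((p + 1)%N :: nseq (q - 1) 1%N)).
  move=> p0 q0.
  have <- : mzv_coef ((p + 1)%N :: nseq (q - 1) 1%N) = opX p (powY q) :> (nat -> R).
    by rewrite mzv_coefS mzv_coef_nseq1 addn1 -powYS -subSn // subSS subn0.
  by apply: has_sum_mzv; rewrite ?all_nseq ?orbT // addn1.
(* Both sides are sums of sequences, so an identity of coefficient sequences suffices. *)
apply: has_sum_unique; first by apply: has_sum_cauchyprod; apply: lhs.
have -> : cauchyprod (opX m (powY j)) (opX n (powY k)) =
    \sum_(n1 < n.+1) \sum_(j1 < j.+1) \sum_(j2 < j.+1 | (j1 + j2 == j)%N)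
      \sum_(a : (j1 + 1).-tuple 'I_(n - n1 + j1 + 1).+1 | is_comp a)
        ('C(m - 1 + n1, m - 1)%:R * 'C(j2 + k - 1, k - 1)%:R)
        *: opX (m + n1) (compX (powY (j2 + k - 1).+1) (map val a))
  + \sum_(t < k) \sum_(m1 < m) \sum_(m2 < m | (m1 + m2 == m - 1)%N)
      \sum_(b : (k - t + 1).-tuple 'I_(m2 + (k - t) + 1).+1 | is_comp b)
        ('C(m1 + n - 1, n - 1)%:R * 'C(j + t, j)%:R)
        *: opX (m1 + n) (compX (opX 1 (powY (j + t - 1).+1)) (map val b))
  :> (nat -> R); last first.
  apply: has_sumD.
    do 4![apply: has_sum_sum => ? ?]; apply: has_sumZ; first by rewrite mulr_ge0.
    by apply: has_sum_first_index => //; rewrite addn1.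
  apply: has_sum_sum => t _; do 3![apply: has_sum_sum => ? ?].
  apply: has_sumZ; first by rewrite mulr_ge0.
  by apply: has_sum_second_index; rewrite ?addn1 ?subn_gt0.
case: m n k hm hn hk {lhs} => [|m] [|n] [|k] // _ _ _.
rewrite cauchyprod_XY_XY //; congr (_ + _).
  apply: eq_bigr => n1 _; rewrite cauchyprod_powY_XpowY !linear_sum /=.
  apply: eq_bigr => j1 _.
  under [RHS]eq_bigr => j2 _.
    rewrite -scaler_sumr -linear_sum /=.
    (* The excess of the weight of [a] over its number of parts is the number [n.+1 - n1] of letters
       x left. *)
    rewrite (sum_is_comp _ _ j1 _ _ (n.+1 - n1)); [|lia|lia].
    over.
  rewrite (sum_add_eq _ _ _ (fun j2 => ('C(m.+1 - 1 + n1, m.+1 - 1)%:R * 'C(j2 + k.+1 - 1, k.+1 - 1)%:R)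
    *: opX (m.+1 + n1) (shuffleXY j1 (n.+1 - n1) (powY (j2 + k.+1 - 1).+1)))).
    rewrite linearZ /= scalerA !subn1 /= !addnS.
    by [].
  by rewrite leq_ord ltnSn.
rewrite exchange_big /=; apply: eq_bigr => m1 _.
rewrite /shuffle_then_x !linear_sum /=.
apply: eq_bigr => t _.
under [RHS]eq_bigr => m2 _.
  rewrite -scaler_sumr -linear_sum /=.
  rewrite (sum_is_comp _ _ (k.+1 - t) _ _ m2); [|lia|lia].
  over.
rewrite (sum_add_eq _ _ _ (fun m2 => ('C(m1 + n.+1 - 1, n.+1 - 1)%:R * 'C(j + t, j)%:R)
    *: opX (m1 + n.+1) (shuffleXY (k.+1 - t) m2 (opX 1 (powY (j + t - 1).+1))))).
  (* As j > 0, the successor of [j + t - 1] is [j + t], the length of the final block of y. *)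
  by rewrite !linearZ /= scalerA mulrC !subn1 /= !addnS /= prednK ?addn_gt0 ?hj.
by have := ltn_ord m1; lia.
Qed.
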